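(* Let $b\geq 2$ be an integer. For all real $x$ and $y$ with $x<y$, \[ h_b\left(\frac{x+y}{2}\right)\leq \frac{h_b(x)+h_b(y)}{2}+\frac14\left[\frac{b+1}{2}\right](y-x). \]
   Context: For an integer $b\geq 2$, let $g_b:\mathbb{R}\to\mathbb{R}$ be the $1$-periodic continuous function given on $[0,1)$ by $g_b(x)=\int_0^x\left(\frac{b-1}{2}-[bt]\right)dt$, and define $h_b(x)=\sum_{n=0}^\infty b^{-n}g_b(b^nx)$ for real $x$. Here $[x]$ denotes the greatest integer less than or equal to $x$. *)

(* Defs.v *)
From Stdlib Require Import Reals.
From Coquelicot Require Import Coquelicot.
Open Scope R_scope.

(* Stdlib's [Int_part] is the floor function and [frac_part x] is
   [x - IZR (Int_part x)], which lies in [0,1) for every real x. *)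

Definition g_integrand (b : nat) (t : R) : R :=
  (INR b - 1) / 2 - IZR (Int_part (INR b * t)).

(* The integrand is a step function, hence Riemann integrable on [0,1], so
   [RInt] is its genuine integral. Taking [frac_part x] as upper bound is the
   1-periodic extension of the formula on [0,1). *)
Definition g (b : nat) (x : R) : R :=
  RInt (g_integrand b) 0 (frac_part x).

(* For b >= 2 the function [g b] is bounded, so the series converges absolutely
   and [Series] is its genuine sum. *)
Definition h (b : nat) (x : R) : R :=
  Series (fun n : nat => / INR b ^ n * g b (INR b ^ n * x)).

(* Main.v *)
Require Import Defs.
From Stdlib Require Import Reals ZArith Lia Lra.
From Coquelicot Require Import Coquelicot.
Open Scope R_scope.

(* Let [Q] be the 1-periodic extension of [x (1 - x) / 2] from [0, 1], and [psi]
   the distance to the nearest even integer.  Integrating the floor function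
   gives [g b x = b Q(x) - Q(b x) / b].  Hence the [n]-th partial sum of [h b], with
   argument and value rescaled by [b ^ n], is obtained by iterating
   [F |-> b F(x / b) + b^2 Q(x / b) - Q(x)] from [0], and it is affine between
   consecutive integers.  Let [c >= b / 2] be an integer.  The iteration
   preserves the inequality
     [2 F((u + w) / 2) - F(u) - F(w) <= c / 2 * (w - u - |psi w - psi u|)],
   which is sharper than what is needed.  Indeed both sides are piecewise
   affine, so it need only be checked at integers, where the contribution of
   [Q] is at most [(D^2 - d^2) / 4] with [D = b |psi (w / b) - psi (u / b)| <= b]
   and [d = |psi w - psi u| <= 1]: as [D] and [d] are integers of the same
   parity, this is at most [c / 2 * (D - d)]. *)

Lemma floor_decomposition (x : R) :
  exists (i : Z) (t : R), x = IZR i + t /\ 0 <= t < 1.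
Proof.
  exists (Int_part x), (frac_part x); split.
  - apply Rplus_Int_part_frac_part.
  - destruct (base_fp x); lra.
Qed.

Lemma frac_part_shift (k : Z) (x : R) : frac_part (IZR k + x) = frac_part x.
Proof.
  symmetry; apply (Int_part_frac_part_spec _ (k + Int_part x)).
  - destruct (base_fp x); lra.
  - rewrite plus_IZR; unfold frac_part; ring.
Qed.

Lemma le_double_floor_half_succ (n : Z) :
  (n <= 2 * Int_part ((IZR n + 1) / 2))%Z.
Proof.
  destruct (base_Int_part ((IZR n + 1) / 2)) as [_ Hlow].
  apply Z.lt_succ_r, lt_IZR; rewrite succ_IZR, mult_IZR; lra.
Qed.

Lemma IZR_mod_2_bounds (i : Z) : 0 <= IZR (i mod 2) <= 1.
Proof.
  pose proof (Z.mod_pos_bound i 2 ltac:(lia)); split; apply IZR_le; lia.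
Qed.

(** * Functions that are quadratic between consecutive integers *)

(* [kappa] is the second derivative on each cell. *)
Definition cellwise_quadratic (kappa : R) (F : R -> R) : Prop :=
  forall (i : Z) (t : R), 0 <= t <= 1 ->
    F (IZR i + t)
      = (1 - t) * F (IZR i) + t * F (IZR i + 1) + kappa * (t * (t - 1) / 2).

Notation cellwise_affine := (cellwise_quadratic 0).

Lemma cellwise_quadratic_div (kappa : R) (F : R -> R) (m : Z) :
  (0 < m)%Z -> cellwise_quadratic kappa F ->
  cellwise_quadratic (kappa / IZR m ^ 2) (fun x => F (x / IZR m)).
Proof.
  intros Hm HF i t Ht.
  set (k := (i / m)%Z); set (r := (i mod m)%Z).
  assert (Ei : i = (m * k + r)%Z) by (apply Z.div_mod; lia).
  assert (Hr : (0 <= r < m)%Z) by (apply Z.mod_pos_bound, Hm).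
  assert (Hr0 : 0 <= IZR r) by (apply IZR_le; lia).
  assert (Hr1 : IZR r + 1 <= IZR m) by (rewrite <- plus_IZR; apply IZR_le; lia).
  assert (in_cell : forall s, 0 <= s <= 1 ->
    F ((IZR i + s) / IZR m)
    = (1 - (IZR r + s) / IZR m) * F (IZR k)
      + (IZR r + s) / IZR m * F (IZR k + 1)
      + kappa * ((IZR r + s) / IZR m * ((IZR r + s) / IZR m - 1) / 2)).
  { intros s Hs; rewrite <- HF.
    - f_equal; rewrite Ei, plus_IZR, mult_IZR; field; lra.
    - split; [apply Rcomplements.Rdiv_le_0_compat; lra |].
      apply Rcomplements.Rle_div_l; lra. }
  pose proof (in_cell 0 ltac:(lra)) as at_left_end.
  rewrite Rplus_0_r in at_left_end.
  rewrite at_left_end, !in_cell by lra; field; lra.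
Qed.

Lemma cellwise_affine_div (F : R -> R) (m : Z) :
  (0 < m)%Z -> cellwise_affine F -> cellwise_affine (fun x => F (x / IZR m)).
Proof.
  intros Hm HF; rewrite <- (Rmult_0_l (/ IZR m ^ 2)).
  exact (cellwise_quadratic_div 0 F m Hm HF).
Qed.

Section MidpointInequalityFromIntegers.

Variables F G K : R -> R.
Hypothesis F_affine : cellwise_affine F.
Hypothesis G_affine : cellwise_affine G.
Hypothesis K_affine : cellwise_affine K.
Hypothesis le_at_integers : forall i j : Z, (i <= j)%Z ->
  2 * F ((IZR i + IZR j) / 2) <= G (IZR i) + K (IZR j).

(* The two sides are affine in [(p, q)] on the triangle [p <= q]. *)
Lemma midpoint_le_on_diagonal_square (i : Z) (p q : R) :
  0 <= p -> p <= q -> q <= 1 ->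
  2 * F ((IZR i + p + (IZR i + q)) / 2) <= G (IZR i + p) + K (IZR i + q).
Proof.
  intros Hp Hpq Hq.
  pose proof (le_at_integers i i ltac:(lia)) as vertex00.
  pose proof (le_at_integers i (i + 1) ltac:(lia)) as vertex01.
  pose proof (le_at_integers (i + 1) (i + 1) ltac:(lia)) as vertex11.
  rewrite plus_IZR in *.
  replace ((IZR i + IZR i) / 2) with (IZR i) in vertex00 by field.
  replace ((IZR i + (IZR i + 1)) / 2) with (IZR i + 1 / 2) in vertex01 by field.
  replace ((IZR i + 1 + (IZR i + 1)) / 2) with (IZR i + 1) in vertex11 by field.
  rewrite (F_affine i (1 / 2)) in vertex01 by lra.
  replace ((IZR i + p + (IZR i + q)) / 2) with (IZR i + (p + q) / 2) by field.
  rewrite (F_affine i ((p + q) / 2)), (G_affine i p), (K_affine i q) by lra.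
  apply (Rmult_le_compat_l (1 - q)) in vertex00; [| lra].
  apply (Rmult_le_compat_l (q - p)) in vertex01; [| lra].
  apply (Rmult_le_compat_l p) in vertex11; lra.
Qed.

(* The two sides are affine in [(p, q)] on the triangles [p + q <= 1] and
   [1 <= p + q]. *)
Lemma midpoint_le_off_diagonal_square (i j : Z) (p q : R) :
  (i < j)%Z -> 0 <= p <= 1 -> 0 <= q <= 1 ->
  2 * F ((IZR i + p + (IZR j + q)) / 2) <= G (IZR i + p) + K (IZR j + q).
Proof.
  intros Hij Hp Hq.
  assert (F_half_affine : cellwise_affine (fun x => F (x / 2)))
    by (apply (cellwise_affine_div F 2); [lia | exact F_affine]).
  pose proof (le_at_integers i j ltac:(lia)) as vertex00.
  pose proof (le_at_integers i (j + 1) ltac:(lia)) as vertex01.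
  pose proof (le_at_integers (i + 1) j ltac:(lia)) as vertex10.
  pose proof (le_at_integers (i + 1) (j + 1) ltac:(lia)) as vertex11.
  rewrite !plus_IZR in *.
  set (s := IZR i + IZR j) in *.
  replace (IZR i + 1 + IZR j) with (s + 1) in vertex10 by (unfold s; ring).
  replace (IZR i + (IZR j + 1)) with (s + 1) in vertex01 by (unfold s; ring).
  replace (IZR i + 1 + (IZR j + 1)) with (s + 1 + 1) in vertex11
    by (unfold s; ring).
  rewrite (G_affine i p), (K_affine j q) by lra.
  destruct (Rle_dec (p + q) 1) as [Hle | Hgt].
  - pose proof (F_half_affine (i + j)%Z (p + q) ltac:(lra)) as EF; simpl in EF.
    rewrite plus_IZR in EF; fold s in EF.
    replace (IZR i + p + (IZR j + q)) with (s + (p + q)) by (unfold s; ring).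
    rewrite EF.
    apply (Rmult_le_compat_l (1 - p - q)) in vertex00; [| lra].
    apply (Rmult_le_compat_l q) in vertex01; [| lra].
    apply (Rmult_le_compat_l p) in vertex10; lra.
  - pose proof (F_half_affine (i + j + 1)%Z (p + q - 1) ltac:(lra)) as EF.
    simpl in EF; rewrite !plus_IZR in EF; fold s in EF.
    replace (IZR i + p + (IZR j + q)) with (s + 1 + (p + q - 1))
      by (unfold s; ring).
    rewrite EF.
    apply (Rmult_le_compat_l (p + q - 1)) in vertex11; [| lra].
    apply (Rmult_le_compat_l (1 - p)) in vertex01; [| lra].
    apply (Rmult_le_compat_l (1 - q)) in vertex10; lra.
Qed.

Lemma midpoint_le_of_integers (u w : R) :
  u <= w -> 2 * F ((u + w) / 2) <= G u + K w.
Proof.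
  intros Huw.
  destruct (floor_decomposition u) as (i & p & -> & Hp).
  destruct (floor_decomposition w) as (j & q & -> & Hq).
  assert (Hij : (i <= j)%Z) by (apply Z.lt_succ_r, lt_IZR; rewrite succ_IZR; lra).
  destruct (Z.eq_dec i j) as [<- | Hne].
  - apply midpoint_le_on_diagonal_square; lra.
  - apply midpoint_le_off_diagonal_square; lia || lra.
Qed.

End MidpointInequalityFromIntegers.

(** * The triangle wave of period 2 *)

Definition triangle_wave (x : R) : R :=
  Rabs (x - 2 * IZR (Int_part ((x + 1) / 2))).

Lemma triangle_wave_near_even (k : Z) (s : R) :
  -1 <= s <= 1 -> triangle_wave (2 * IZR k + s) = Rabs s.
Proof.
  intros Hs; unfold triangle_wave.
  destruct (Req_dec s 1) as [-> | Hne].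
  - rewrite <- (Int_part_spec _ (k + 1)) by (rewrite plus_IZR; lra).
    rewrite plus_IZR.
    replace (2 * IZR k + 1 - 2 * (IZR k + 1)) with (- (1)) by ring.
    apply Rabs_Ropp.
  - rewrite <- (Int_part_spec _ k) by lra.
    f_equal; ring.
Qed.

Lemma even_decomposition (x : R) :
  exists (k : Z) (s : R), x = 2 * IZR k + s /\ -1 <= s <= 1.
Proof.
  destruct (floor_decomposition ((x + 1) / 2)) as (k & t & E & Ht).
  exists k, (2 * t - 1); lra.
Qed.

Lemma triangle_wave_cellwise_affine : cellwise_affine triangle_wave.
Proof.
  intros i t Ht.
  destruct (Z.Even_or_Odd i) as [[k ->] | [k ->]].
  - rewrite mult_IZR, !triangle_wave_near_even by lra.
    rewrite <- (Rplus_0_r (2 * IZR k)) at 1.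
    rewrite triangle_wave_near_even, Rabs_R0, Rabs_R1, Rabs_pos_eq by lra; ring.
  - replace (IZR (2 * k + 1)) with (2 * IZR (k + 1) + -1)
      by (rewrite !plus_IZR, mult_IZR; ring).
    rewrite !Rplus_assoc, !triangle_wave_near_even by lra.
    rewrite !Rabs_left1 by lra; ring.
Qed.

Lemma triangle_wave_IZR (i : Z) : triangle_wave (IZR i) = IZR (i mod 2).
Proof.
  pose proof (IZR_mod_2_bounds i).
  rewrite (Z.div_mod i 2) at 1 by lia.
  rewrite plus_IZR, mult_IZR, triangle_wave_near_even by lra.
  apply Rabs_pos_eq; lra.
Qed.

Lemma triangle_wave_fraction (b i : Z) :
  (0 < b)%Z ->
  exists s : Z, IZR b * triangle_wave (IZR i / IZR b) = IZR s /\
    (0 <= s <= b)%Z /\ (s mod 2 = i mod 2)%Z.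
Proof.
  intros Hb; assert (Hb' : 0 < IZR b) by (apply IZR_lt, Hb).
  destruct (even_decomposition (IZR i / IZR b)) as (k & s & E & Hs).
  assert (Es : IZR b * s = IZR (i - 2 * b * k)).
  { rewrite minus_IZR, !mult_IZR.
    replace s with (IZR i / IZR b - 2 * IZR k) by lra; field; lra. }
  exists (Z.abs (i - 2 * b * k)); repeat split.
  - rewrite E, triangle_wave_near_even, abs_IZR, <- Es, Rabs_mult by exact Hs.
    rewrite (Rabs_pos_eq (IZR b)) by lra; reflexivity.
  - lia.
  - apply Z.abs_le; split; apply le_IZR; rewrite ?opp_IZR, <- Es; nra.
  - replace (i - 2 * b * k)%Z with (i - 2 * (b * k))%Z by ring.
    generalize (b * k)%Z as n; intros n; Z.to_euclidean_division_equations; lia.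
Qed.

Definition wave_gap (u w : R) : R := Rabs (triangle_wave w - triangle_wave u).

Lemma wave_gap_IZR (i j : Z) : wave_gap (IZR i) (IZR j) = IZR ((j - i) mod 2).
Proof.
  unfold wave_gap; rewrite !triangle_wave_IZR, <- minus_IZR, <- abs_IZR.
  f_equal; Z.to_euclidean_division_equations; lia.
Qed.

Lemma wave_gap_fraction (b i j : Z) :
  (0 < b)%Z ->
  exists D : Z, IZR b * wave_gap (IZR i / IZR b) (IZR j / IZR b) = IZR D /\
    (0 <= D <= b)%Z /\ (D mod 2 = (j - i) mod 2)%Z.
Proof.
  intros Hb; assert (Hb' : 0 < IZR b) by (apply IZR_lt, Hb).
  destruct (triangle_wave_fraction b i Hb) as (s & Es & Hs & Ps).
  destruct (triangle_wave_fraction b j Hb) as (t & Et & Ht & Pt).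
  exists (Z.abs (t - s)); repeat split; [| lia | lia |].
  - unfold wave_gap; rewrite abs_IZR, minus_IZR, <- Es, <- Et.
    rewrite <- Rmult_minus_distr_l, Rabs_mult, (Rabs_pos_eq (IZR b)) by lra.
    reflexivity.
  - Z.to_euclidean_division_equations; lia.
Qed.

(** * The periodic parabola *)

Definition parabolic_wave (x : R) : R := frac_part x * (1 - frac_part x) / 2.

Lemma parabolic_wave_near_integer (k : Z) (s : R) :
  -1 <= s <= 1 -> parabolic_wave (IZR k + s) = Rabs s * (1 - Rabs s) / 2.
Proof.
  intros Hs; unfold parabolic_wave; rewrite frac_part_shift.
  destruct (Rle_lt_dec 0 s) as [Hnonneg | Hneg].
  - rewrite Rabs_pos_eq by exact Hnonneg.
    destruct (Req_dec s 1) as [-> | Hne].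
    + rewrite <- (proj2 (Int_part_frac_part_spec 1 1 0 ltac:(lra) ltac:(ring))).
      field.
    + rewrite <- (proj2 (Int_part_frac_part_spec s 0 s ltac:(lra) ltac:(ring))).
      reflexivity.
  - rewrite <- (proj2 (Int_part_frac_part_spec s (-1) (s + 1)
      ltac:(lra) ltac:(ring))), Rabs_left by exact Hneg.
    field.
Qed.

Lemma parabolic_wave_IZR (k : Z) : parabolic_wave (IZR k) = 0.
Proof.
  rewrite <- (Rplus_0_r (IZR k)), parabolic_wave_near_integer, Rabs_R0 by lra.
  field.
Qed.

Lemma parabolic_wave_cellwise_quadratic : cellwise_quadratic (-1) parabolic_wave.
Proof.
  intros i t Ht.
  rewrite parabolic_wave_IZR, !parabolic_wave_near_integer by lra.
  rewrite Rabs_R1, Rabs_pos_eq by lra; field.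
Qed.

Lemma parabolic_wave_bounds (x : R) : 0 <= parabolic_wave x <= 1 / 8.
Proof.
  unfold parabolic_wave; destruct (base_fp x).
  pose proof (pow2_ge_0 (frac_part x - 1 / 2)).
  split; nra.
Qed.

Lemma is_RInt_floor_cell (n : Z) (t : R) :
  0 <= t <= 1 ->
  is_RInt (fun s => IZR (Int_part s)) (IZR n) (IZR n + t) (t * IZR n).
Proof.
  intros Ht; apply is_RInt_ext with (fun _ => IZR n).
  - rewrite Rmin_left, Rmax_right by lra.
    intros s Hs; f_equal; apply Int_part_spec; lra.
  - replace (t * IZR n) with ((IZR n + t - IZR n) * IZR n) by ring.
    apply (@is_RInt_const R_NormedModule).
Qed.

Lemma is_RInt_floor_INR (n : nat) :
  is_RInt (fun s => IZR (Int_part s)) 0 (INR n) (INR n * (INR n - 1) / 2).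
Proof.
  induction n as [| n IH].
  - simpl INR; replace (0 * (0 - 1) / 2) with 0 by field.
    apply (@is_RInt_point R_NormedModule).
  - pose proof (is_RInt_floor_cell (Z.of_nat n) 1 ltac:(lra)) as Hcell.
    rewrite <- INR_IZR_INZ in Hcell; rewrite S_INR.
    replace ((INR n + 1) * (INR n + 1 - 1) / 2)
      with (INR n * (INR n - 1) / 2 + 1 * INR n) by field.
    exact (is_RInt_Chasles _ _ _ _ _ _ IH Hcell).
Qed.

Lemma is_RInt_floor (x : R) :
  0 <= x ->
  is_RInt (fun s => IZR (Int_part s)) 0 x (x * (x - 1) / 2 + parabolic_wave x).
Proof.
  intros Hx.
  destruct (floor_decomposition x) as (i & t & -> & Ht).
  assert (Hi : (0 <= i)%Z) by (apply Z.lt_succ_r, lt_IZR; rewrite succ_IZR; lra).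
  pose proof (is_RInt_floor_INR (Z.to_nat i)) as Hint.
  rewrite INR_IZR_INZ, Z2Nat.id in Hint by exact Hi.
  pose proof (is_RInt_floor_cell i t ltac:(lra)) as Hcell.
  rewrite parabolic_wave_near_integer, Rabs_pos_eq by lra.
  replace ((IZR i + t) * (IZR i + t - 1) / 2 + t * (1 - t) / 2)
    with (IZR i * (IZR i - 1) / 2 + t * IZR i) by field.
  exact (is_RInt_Chasles _ _ _ _ _ _ Hint Hcell).
Qed.

Lemma g_eq_parabolic_wave (b : nat) (x : R) :
  (0 < b)%nat ->
  g b x = INR b * parabolic_wave x - parabolic_wave (INR b * x) / INR b.
Proof.
  intros Hb; apply lt_0_INR in Hb.
  set (f := frac_part x).
  assert (Hf : 0 <= f < 1) by (unfold f; destruct (base_fp x); lra).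
  assert (periodic : parabolic_wave (INR b * x) = parabolic_wave (INR b * f)).
  { unfold parabolic_wave.
    rewrite (Rplus_Int_part_frac_part x), Rmult_plus_distr_l, INR_IZR_INZ.
    rewrite <- mult_IZR, frac_part_shift; reflexivity. }
  rewrite periodic; unfold g; apply is_RInt_unique; fold f.
  assert (Hfloor : is_RInt
    (fun t => scal (INR b) (IZR (Int_part (INR b * t + 0)))) 0 f
    (INR b * f * (INR b * f - 1) / 2 + parabolic_wave (INR b * f))).
  { apply (is_RInt_comp_lin (fun t => IZR (Int_part t))).
    rewrite Rmult_0_r, !Rplus_0_r; apply is_RInt_floor; nra. }
  apply (is_RInt_scal _ _ _ (/ INR b)) in Hfloor.
  pose proof (is_RInt_minus _ _ _ _ _ _
    (@is_RInt_const R_NormedModule 0 f ((INR b - 1) / 2)) Hfloor) as Hdiff.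
  replace (INR b * parabolic_wave x - parabolic_wave (INR b * f) / INR b)
    with ((f - 0) * ((INR b - 1) / 2)
          - / INR b * (INR b * f * (INR b * f - 1) / 2
                       + parabolic_wave (INR b * f)))
    by (change (parabolic_wave x) with (f * (1 - f) / 2); field; lra).
  refine (is_RInt_ext _ _ _ _ _ _ Hdiff); intros t _.
  change ((INR b - 1) / 2 - / INR b * (INR b * IZR (Int_part (INR b * t + 0)))
    = g_integrand b t).
  unfold g_integrand; rewrite Rplus_0_r; field; lra.
Qed.

Lemma g_bounded (b : nat) (x : R) : (0 < b)%nat -> Rabs (g b x) <= INR b.
Proof.
  intros Hb; rewrite g_eq_parabolic_wave by exact Hb.
  assert (Hb' : 1 <= INR b) by (apply (le_INR 1), Hb).
  assert (Hinv : 0 < / INR b <= 1).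
  { split; [apply Rinv_0_lt_compat; lra |].
    rewrite <- Rinv_1; apply Rinv_le_contravar; lra. }
  pose proof (parabolic_wave_bounds x).
  pose proof (parabolic_wave_bounds (INR b * x)).
  apply Rabs_le; unfold Rdiv; split; nra.
Qed.

Definition midpoint_excess (F : R -> R) (u w : R) : R :=
  2 * F ((u + w) / 2) - F u - F w.

Lemma parabolic_wave_excess_le (u w : R) :
  midpoint_excess parabolic_wave u w <= wave_gap u w ^ 2 / 4.
Proof.
  unfold wave_gap; rewrite pow2_abs.
  destruct (even_decomposition u) as (k & s & -> & Hs).
  destruct (even_decomposition w) as (l & t & -> & Ht).
  unfold midpoint_excess.
  replace ((2 * IZR k + s + (2 * IZR l + t)) / 2)
    with (IZR (k + l) + (s + t) / 2) by (rewrite plus_IZR; field).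
  rewrite <- !mult_IZR, !parabolic_wave_near_integer, !mult_IZR by lra.
  rewrite !triangle_wave_near_even by lra.
  (* Equality holds when [s] and [t] have the same sign. *)
  unfold Rabs; repeat destruct Rcase_abs; nra.
Qed.

Lemma parabolic_wave_excess_IZR (i j : Z) :
  midpoint_excess parabolic_wave (IZR i) (IZR j)
    = wave_gap (IZR i) (IZR j) ^ 2 / 4.
Proof.
  unfold wave_gap; rewrite pow2_abs.
  assert (bit_idempotent : forall n,
    IZR (n mod 2) * IZR (n mod 2) = IZR (n mod 2)).
  { intros n; rewrite <- mult_IZR; f_equal.
    pose proof (Z.mod_pos_bound n 2 ltac:(lia)); nia. }
  unfold midpoint_excess; rewrite !parabolic_wave_IZR, !triangle_wave_IZR.
  replace ((IZR i + IZR j) / 2)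
    with (IZR (i / 2 + j / 2) + (IZR (i mod 2) + IZR (j mod 2)) / 2).
  2: { rewrite (Z.div_mod i 2) at 3 by lia; rewrite (Z.div_mod j 2) at 3 by lia.
       rewrite !plus_IZR, !mult_IZR; field. }
  pose proof (IZR_mod_2_bounds i); pose proof (IZR_mod_2_bounds j).
  rewrite parabolic_wave_near_integer, Rabs_pos_eq by lra.
  pose proof (bit_idempotent i); pose proof (bit_idempotent j); nra.
Qed.

(** * Preservation of the midpoint inequality under refinement *)

Definition wave_midconvex (c : R) (F : R -> R) : Prop :=
  forall u w : R, u <= w ->
    midpoint_excess F u w <= c / 2 * (w - u - wave_gap u w).

Lemma wave_midconvex_of_integers (c : R) (F : R -> R) :
  0 <= c -> cellwise_affine F ->
  (forall i j : Z, (i <= j)%Z ->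
    midpoint_excess F (IZR i) (IZR j)
      <= c / 2 * (IZR j - IZR i - wave_gap (IZR i) (IZR j))) ->
  wave_midconvex c F.
Proof.
  intros Hc HF Hgrid u w Huw.
  assert (signed : forall e, Rabs e = 1 ->
    midpoint_excess F u w
      <= c / 2 * (w - u - e * (triangle_wave w - triangle_wave u))).
  { intros e He.
    enough (2 * F ((u + w) / 2)
      <= (F u - c / 2 * (u - e * triangle_wave u))
         + (F w + c / 2 * (w - e * triangle_wave w)))
      by (unfold midpoint_excess; lra).
    apply (midpoint_le_of_integers F
      (fun x => F x - c / 2 * (x - e * triangle_wave x))
      (fun x => F x + c / 2 * (x - e * triangle_wave x))); auto.
    1, 2: intros i t Ht;
      rewrite (HF i t Ht), (triangle_wave_cellwise_affine i t Ht); ring.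
    intros i j Hij; specialize (Hgrid i j Hij).
    unfold midpoint_excess, wave_gap in Hgrid.
    set (d := triangle_wave (IZR j) - triangle_wave (IZR i)) in *.
    assert (Hd : e * d <= Rabs d).
    { rewrite <- (Rmult_1_l (Rabs d)), <- He, <- Rabs_mult; apply Rle_abs. }
    apply (Rmult_le_compat_l (c / 2)) in Hd; [unfold d in *; lra | lra]. }
  unfold wave_gap, Rabs; destruct Rcase_abs.
  - pose proof (signed (-1) ltac:(rewrite Rabs_left; lra)); lra.
  - pose proof (signed 1 Rabs_R1); lra.
Qed.

Lemma sqr_sub_sqr_parity_le (c D : Z) :
  (0 <= D <= 2 * c)%Z ->
  (D ^ 2 - (D mod 2) ^ 2 <= 2 * c * (D - D mod 2))%Z.
Proof.
  intros HD.
  assert (Hfactors : (0 <= D - D mod 2 /\ 0 <= 2 * c - D - D mod 2)%Z)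
    by (Z.to_euclidean_division_equations; lia).
  nia.
Qed.

Lemma parabolic_wave_excess_div_le (b c i j : Z) :
  (0 < b)%Z -> (b <= 2 * c)%Z ->
  IZR b ^ 2 * midpoint_excess parabolic_wave (IZR i / IZR b) (IZR j / IZR b)
    - midpoint_excess parabolic_wave (IZR i) (IZR j)
  <= IZR c / 2 * (IZR b * wave_gap (IZR i / IZR b) (IZR j / IZR b)
                  - wave_gap (IZR i) (IZR j)).
Proof.
  intros Hb Hc.
  destruct (wave_gap_fraction b i j Hb) as (D & ED & HD & Hparity).
  pose proof (parabolic_wave_excess_le (IZR i / IZR b) (IZR j / IZR b)) as HQ.
  apply (Rmult_le_compat_l (IZR b ^ 2)) in HQ; [| apply pow2_ge_0].
  replace (IZR b ^ 2 * (wave_gap (IZR i / IZR b) (IZR j / IZR b) ^ 2 / 4))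
    with (IZR D ^ 2 / 4) in HQ by (rewrite <- ED; field).
  rewrite parabolic_wave_excess_IZR, ED, wave_gap_IZR, <- Hparity.
  pose proof (sqr_sub_sqr_parity_le c D ltac:(lia)) as Hint.
  apply IZR_le in Hint.
  rewrite !Z.pow_2_r, mult_IZR, !minus_IZR, !mult_IZR in Hint; lra.
Qed.

(* The map sending one rescaled partial sum of [h b] to the next. *)
Definition refinement (b : nat) (F : R -> R) (x : R) : R :=
  INR b * (F (x / INR b) + g b (x / INR b)).

Lemma refinement_eq_parabolic_wave (b : nat) (F : R -> R) (x : R) :
  (0 < b)%nat ->
  refinement b F x
    = INR b * F (x / INR b) + INR b ^ 2 * parabolic_wave (x / INR b)
      - parabolic_wave x.
Proof.
  intros Hb; assert (Hb' := lt_0_INR b Hb).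
  unfold refinement; rewrite g_eq_parabolic_wave by exact Hb.
  replace (INR b * (x / INR b)) with x by (field; lra).
  field; lra.
Qed.

Lemma refinement_cellwise_affine (b : nat) (F : R -> R) :
  (0 < b)%nat -> cellwise_affine F -> cellwise_affine (refinement b F).
Proof.
  intros Hb HF i t Ht; assert (Hb' := lt_0_INR b Hb).
  assert (HbZ : (0 < Z.of_nat b)%Z) by lia.
  pose proof (cellwise_affine_div F _ HbZ HF i t Ht) as EF.
  pose proof (parabolic_wave_cellwise_quadratic i t Ht) as EQ.
  pose proof (cellwise_quadratic_div _ _ _ HbZ parabolic_wave_cellwise_quadratic
    i t Ht) as EQ_div.
  rewrite <- INR_IZR_INZ in EF, EQ_div; simpl in EF, EQ_div.
  rewrite !refinement_eq_parabolic_wave, EF, EQ, EQ_div by exact Hb.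
  field; lra.
Qed.

Lemma refinement_wave_midconvex (b : nat) (c : Z) (F : R -> R) :
  (0 < b)%nat -> (Z.of_nat b <= 2 * c)%Z -> cellwise_affine F ->
  wave_midconvex (IZR c) F -> wave_midconvex (IZR c) (refinement b F).
Proof.
  intros Hb Hc HF Hmid; assert (Hb' := lt_0_INR b Hb).
  apply wave_midconvex_of_integers;
    [apply IZR_le; lia | apply refinement_cellwise_affine; assumption |].
  intros i j Hij; apply IZR_le in Hij.
  assert (split_excess : midpoint_excess (refinement b F) (IZR i) (IZR j)
    = INR b * midpoint_excess F (IZR i / INR b) (IZR j / INR b)
      + (INR b ^ 2
           * midpoint_excess parabolic_wave (IZR i / INR b) (IZR j / INR b)
         - midpoint_excess parabolic_wave (IZR i) (IZR j))).
  { unfold midpoint_excess; rewrite !refinement_eq_parabolic_wave by exact Hb.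
    replace ((IZR i + IZR j) / 2 / INR b)
      with ((IZR i / INR b + IZR j / INR b) / 2) by (field; lra).
    ring. }
  assert (F_bound : INR b * midpoint_excess F (IZR i / INR b) (IZR j / INR b)
    <= IZR c / 2 * (IZR j - IZR i
                    - INR b * wave_gap (IZR i / INR b) (IZR j / INR b))).
  { eapply Rle_trans; [apply Rmult_le_compat_l; [lra | apply Hmid] |].
    - apply Rmult_le_compat_r; [apply Rlt_le, Rinv_0_lt_compat |]; lra.
    - right; field; lra. }
  pose proof (parabolic_wave_excess_div_le (Z.of_nat b) c i j ltac:(lia) Hc)
    as Q_bound.
  rewrite <- INR_IZR_INZ in Q_bound; lra.
Qed.

(** * The partial sums of the series *)

(* The sum of the first [n] terms of [h b], with argument and value both
   rescaled by [b ^ n]. *)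
Definition scaled_sum (b n : nat) : R -> R :=
  Nat.iter n (refinement b) (fun _ => 0).

Lemma scaled_sum_cellwise_affine (b n : nat) :
  (0 < b)%nat -> cellwise_affine (scaled_sum b n).
Proof.
  intros Hb; induction n as [| n IH].
  - intros i t Ht; simpl; field.
  - apply refinement_cellwise_affine; assumption.
Qed.

Lemma scaled_sum_wave_midconvex (b n : nat) (c : Z) :
  (0 < b)%nat -> (Z.of_nat b <= 2 * c)%Z ->
  wave_midconvex (IZR c) (scaled_sum b n).
Proof.
  intros Hb Hc; induction n as [| n IH].
  - apply wave_midconvex_of_integers;
      [apply IZR_le; lia | apply scaled_sum_cellwise_affine, Hb |].
    intros i j Hij; unfold midpoint_excess; simpl.
    rewrite wave_gap_IZR, <- !minus_IZR.
    assert (0 <= IZR c * IZR (j - i - (j - i) mod 2)).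
    { apply Rmult_le_pos; apply IZR_le; Z.to_euclidean_division_equations; lia. }
    lra.
  - apply (refinement_wave_midconvex b c (scaled_sum b n)); auto.
    apply scaled_sum_cellwise_affine, Hb.
Qed.

Definition h_term (b : nat) (x : R) (n : nat) : R :=
  / INR b ^ n * g b (INR b ^ n * x).

Lemma sum_n_h_term (b n : nat) (x : R) :
  (0 < b)%nat ->
  sum_n (h_term b x) n = scaled_sum b (S n) (INR b ^ S n * x) / INR b ^ S n.
Proof.
  intros Hb; apply lt_0_INR in Hb.
  assert (scaled_sum_succ : forall m, scaled_sum b (S m) (INR b ^ S m * x)
    = INR b * (scaled_sum b m (INR b ^ m * x) + g b (INR b ^ m * x))).
  { intros m; change (scaled_sum b (S m)) with (refinement b (scaled_sum b m)).
    unfold refinement; replace (INR b ^ S m * x / INR b) with (INR b ^ m * x)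
      by (simpl; field; lra).
    reflexivity. }
  assert (Hpow : forall m, 0 < INR b ^ m) by (intros m; apply pow_lt, Hb).
  induction n as [| n IH].
  - rewrite sum_O, scaled_sum_succ; unfold h_term; simpl; field; lra.
  - rewrite sum_Sn, IH, (scaled_sum_succ (S n)); unfold h_term, plus; simpl.
    specialize (Hpow n); field; lra.
Qed.

Lemma sum_n_h_term_midconvex (b n : nat) (c : Z) (x y : R) :
  (0 < b)%nat -> (Z.of_nat b <= 2 * c)%Z -> x <= y ->
  midpoint_excess (fun z => sum_n (h_term b z) n) x y <= IZR c * ((y - x) / 2).
Proof.
  intros Hb Hc Hxy; unfold midpoint_excess; rewrite !sum_n_h_term by exact Hb.
  assert (HB : 0 < INR b ^ S n) by (apply pow_lt, lt_0_INR, Hb).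
  set (B := INR b ^ S n) in *.
  pose proof (scaled_sum_wave_midconvex b (S n) c Hb Hc (B * x) (B * y)
    ltac:(apply Rmult_le_compat_l; lra)) as Hmid.
  assert (Hgap : 0 <= IZR c * wave_gap (B * x) (B * y)).
  { apply Rmult_le_pos; [apply IZR_le; lia | apply Rabs_pos]. }
  unfold midpoint_excess in Hmid.
  replace ((B * x + B * y) / 2) with (B * ((x + y) / 2)) in Hmid by field.
  apply Rmult_le_reg_l with B; [exact HB |].
  eapply Rle_trans; [| eapply Rle_trans; [exact Hmid | lra]].
  right; field; lra.
Qed.

Lemma ex_series_h_term (b : nat) (x : R) : (2 <= b)%nat -> ex_series (h_term b x).
Proof.
  intros Hb; assert (Hb' : 2 <= INR b) by (apply (le_INR 2), Hb).
  apply (@ex_series_le R_AbsRing R_CompleteNormedModule _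
           (fun n => INR b * (/ INR b) ^ n)).
  - intros n; change norm with Rabs; unfold h_term.
    assert (0 < / INR b ^ n) by (apply Rinv_0_lt_compat, pow_lt; lra).
    rewrite Rabs_mult, Rabs_pos_eq, pow_inv, Rmult_comm by lra.
    apply Rmult_le_compat_r; [lra | apply g_bounded; lia].
  - apply (@ex_series_scal_l R_AbsRing R_NormedModule (INR b)), ex_series_geom.
    rewrite Rabs_pos_eq by (apply Rlt_le, Rinv_0_lt_compat; lra).
    rewrite <- Rinv_1; apply Rinv_lt_contravar; lra.
Qed.

Lemma is_lim_seq_midpoint_excess (f : nat -> R -> R) (F : R -> R) (x y : R) :
  (forall z, is_lim_seq (fun n => f n z) (F z)) ->
  is_lim_seq (fun n => midpoint_excess (f n) x y) (midpoint_excess F x y).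
Proof.
  intros Hlim; unfold midpoint_excess.
  apply is_lim_seq_minus'; [apply is_lim_seq_minus' |]; auto.
  apply (is_lim_seq_scal_l _ 2 (F ((x + y) / 2))), Hlim.
Qed.

Lemma h_midconvex (b : nat) (c : Z) (x y : R) :
  (2 <= b)%nat -> (Z.of_nat b <= 2 * c)%Z -> x <= y ->
  midpoint_excess (h b) x y <= IZR c * ((y - x) / 2).
Proof.
  intros Hb Hc Hxy.
  apply (is_lim_seq_le
    (fun n => midpoint_excess (fun z => sum_n (h_term b z) n) x y)
    (fun _ => IZR c * ((y - x) / 2)) (midpoint_excess (h b) x y)
    (IZR c * ((y - x) / 2))).
  - intros n; apply sum_n_h_term_midconvex; [lia | exact Hc | exact Hxy].
  - apply (is_lim_seq_midpoint_excess (fun n z => sum_n (h_term b z) n)).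
    intros z; apply Series_correct, ex_series_h_term, Hb.
  - apply is_lim_seq_const.
Qed.

Theorem theorem6 (b : nat) (hb : (2 <= b)%nat) (x y : R) (hxy : x < y) :
  h b ((x + y) / 2)
    <= (h b x + h b y) / 2
       + 1 / 4 * IZR (Int_part ((INR b + 1) / 2)) * (y - x).
Proof.
  pose proof (le_double_floor_half_succ (Z.of_nat b)) as Hfloor.
  rewrite <- INR_IZR_INZ in Hfloor.
  pose proof (h_midconvex b _ x y hb Hfloor ltac:(lra)) as Hmid.
  unfold midpoint_excess in Hmid; lra.
Qed.
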